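(* Let $0<\epsilon<1/2$, let $r\ge 2$ be an integer, let $x\ge(1+\epsilon)(r+1)$ be a real number, let $\delta$ be a real number with $\delta<\left(\frac{\epsilon}{6r}\right)^2$, and let $G$ be an $r$-graph with $|G|=\binom{x}{r}$ edges and $K^r_{r+1}(G)>(1-\delta)\binom{x}{r+1}$. Then: (1) There is a set $S$ of $\lceil x\rceil$ vertices of $G$ such that all but at most $10r(\epsilon^{-1}+1)\delta^{1/2}\binom{x}{r}$ edges of $G$ are contained in $S$. (2) There are at most $\delta^{1/2}x$ vertices $v$ with $d(v)>(1+\delta^{1/2})\binom{x-1}{r-1}$. (3) The vertices of degree less than $\binom{(1-\delta^{1/2})(x-1)}{r-1}$ are incident to at most $\delta^{1/2}x\binom{x-1}{r-1}$ edges. (4) There is a set $C$ of vertices of $G$ of size $|C|<(1+3r\delta^{1/2})x$ that contains at least $\binom{(1-4\delta^{1/2})x}{r+1}$ copies of $K^r_{r+1}$.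
   Context: An $r$-graph $G$ consists of a finite vertex set $V(G)$ and a set $E(G)$ of edges, each edge being an $r$-element subset of $V(G)$; $|G|=|E(G)|$. The degree $d(v)$ of a vertex $v$ is the number of edges containing $v$. A copy of $K^r_{r+1}$ in $G$ is an $(r+1)$-element subset of $V(G)$ all of whose $r$-element subsets are edges of $G$; $K^r_{r+1}(G)$ is the number of such copies, and a vertex set $C$ contains a copy if the $(r+1)$-set is a subset of $C$. For real $y$ and integer $k\ge 0$, $\binom{y}{k}=y(y-1)\cdots(y-k+1)/k!$. *)

(* Defs.v *)
From mathcomp Require Import all_boot all_order all_algebra.
From mathcomp Require Import reals.

Set Implicit Arguments.
Unset Strict Implicit.
Unset Printing Implicit Defensive.

Import Order.TTheory GRing.Theory Num.Theory.
Local Open Scope ring_scope.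

(* The vertex set of a hypergraph is the whole finite type V, so isolated
   vertices are allowed; the hypergraph itself is its set E of edges. *)
Definition is_rgraph (V : finType) (r : nat) (E : {set {set V}}) : bool :=
  [forall e in E, #|e| == r].

Definition degree (V : finType) (E : {set {set V}}) (v : V) : nat :=
  #|[set e in E | v \in e]|.

(* The (r+1)-sets of vertices spanning a copy of the complete r-graph
   on r+1 vertices. *)
Definition Kcopies (V : finType) (r : nat) (E : {set {set V}}) :
    {set {set V}} :=
  [set A : {set V} | (#|A| == r.+1) &&
     [forall e : {set V}, ((e \subset A) && (#|e| == r)) ==> (e \in E)]].

(* y (y - 1) ... (y - k + 1) / k! for real y. *)
Definition rbinom (R : realType) (y : R) (k : nat) : R :=
  (\prod_(i < k) (y - i%:R)) / k`!%:R.

(* Main.v *)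
(* Write d(v) and K(v) for the numbers of edges and of copies containing v.
   The inequality r K(v) <= (x - r) d(v), whose sum over v is Lovasz's bound
   (r+1) K(G) <= (x - r)|G|, follows from K(v) <= |G| - d(v) when d(v) is at
   least binom(x-1, r-1), and from Lovasz's bound for the link of v otherwise.
   Vertices of large or small degree make it far from tight, which gives (2)
   and (3).

   For (1) and (4), pick v maximising K(v)/d(v) and pass to its link, r - 1
   times.  The quantity y = r + (r+1) K/|G| drops by at most one at each step
   and rho = |G|/binom(y, r) does not increase, so the 1-graph reached at the
   end has at most rho (y - r + 1) vertices; together with the chosen vertices
   they form a set T of about x vertices.  Few edges are not inside T: the
   edges lost at one step number at most binom(y, r) times the decrease of rho,
   and these losses telescope because deleting m edges by removing vertices
   destroys at most (x/r - 1) m copies.  Here rho - 1 is of order r delta, much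
   smaller than delta^(1/2). *)

Require Import Defs.
From mathcomp Require Import all_boot all_order all_algebra.
From mathcomp Require Import reals.
From mathcomp Require Import ring lra zify.

Set Implicit Arguments.
Unset Strict Implicit.
Unset Printing Implicit Defensive.

Import Order.TTheory GRing.Theory Num.Theory.
Local Open Scope ring_scope.

(** * Estimates for binomial coefficients of a real argument *)

Section Rbinom.
Variable R : realType.
Implicit Types (y z t : R) (r n : nat).

Lemma rbinom0 y : rbinom y 0 = 1.
Proof. by rewrite /rbinom big_ord0 fact0 divr1. Qed.

Lemma rbinomSr y r : r.+1%:R * rbinom y r.+1 = (y - r%:R) * rbinom y r.
Proof.
rewrite /rbinom big_ord_recr /= factS natrM.
have /lt0r_neq0 : 0 < r.+1%:R :> R by rewrite ltr0Sn.
have /lt0r_neq0 : 0 < r`!%:R :> R by rewrite ltr0n fact_gt0.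
by move: (r`!%:R) (r.+1%:R) => a b a0 b0; field; rewrite a0.
Qed.

Lemma rbinomSl y r : r.+1%:R * rbinom y r.+1 = y * rbinom (y - 1) r.
Proof.
rewrite /rbinom big_ord_recl /= factS natrM subr0.
have -> : \prod_(i < r) (y - (lift ord0 i)%:R) = \prod_(i < r) (y - 1 - i%:R).
  by apply: eq_bigr => i _; rewrite /= /bump leq0n add1n -natr1; ring.
have /lt0r_neq0 : 0 < r.+1%:R :> R by rewrite ltr0Sn.
have /lt0r_neq0 : 0 < r`!%:R :> R by rewrite ltr0n fact_gt0.
by move: (r`!%:R) (r.+1%:R) => a b a0 b0; field; rewrite a0.
Qed.

Lemma rbinom_nat n r : rbinom n%:R r = 'C(n, r)%:R :> R.
Proof.
elim: r => [|r IH]; first by rewrite rbinom0 bin0.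
have r1 : r.+1%:R != 0 :> R by rewrite pnatr_eq0.
apply: (mulfI r1); rewrite rbinomSr IH -natrM mul_bin_left.
case: (leqP r n) => rn; first by rewrite natrM natrB.
by rewrite bin_small // !muln0 mulr0.
Qed.

Lemma rbinom_gt0 y r : r%:R < y + 1 -> 0 < rbinom y r.
Proof.
move=> ry; apply: divr_gt0; last by rewrite ltr0n fact_gt0.
apply: prodr_gt0 => i _; have : (i.+1 <= r)%N by [].
by rewrite -(ler_nat R) -natr1; lra.
Qed.

(** Factor by factor, [c * y - i <= c * (y - i)] because [c <= 1]; the lower bound on [c * y] keeps
    the left factors nonnegative. *)
Lemma rbinom_scale (c : R) y r : 0 <= c <= 1 -> r%:R <= c * y + 1 ->
  rbinom (c * y) r <= c ^+ r * rbinom y r.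
Proof.
move=> /andP[c0 c1] ry; rewrite /rbinom mulrA ler_wpM2r //.
  by rewrite invr_ge0 ler0n.
rewrite -[X in c ^+ X]card_ord -prodr_const -big_split /=.
apply: ler_prod => i _; have : (i.+1 <= r)%N by [].
rewrite -(ler_nat R) -natr1 => ir; have := ler0n R i => i0.
by apply/andP; split; nra.
Qed.

Lemma rbinom_le y z r : 0 < z -> r%:R <= z + 1 -> z <= y ->
  rbinom z r <= rbinom y r.
Proof.
move=> z0 rz zy; have y0 : 0 < y by lra.
have zE : z / y * y = z by rewrite divfK // gt_eqF.
have c1 : 0 <= z / y <= 1.
  apply/andP; split; first by apply: divr_ge0; lra.
  by rewrite ler_pdivrMr // mul1r; lra.
rewrite -{1}zE; apply: le_trans (rbinom_scale c1 _) _; first by rewrite zE.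
case: r rz => [|r] rz; first by rewrite !rbinom0 mulr1.
apply: ler_piMl; last by case/andP: c1 => *; rewrite exprn_ile1.
case: (ltP z y) => zy'; first by apply/ltW/rbinom_gt0; lra.
have e : z = y by lra.
rewrite /rbinom divr_ge0 ?ler0n //; apply: prodr_ge0 => i _.
by have : (i.+1 <= r.+1)%N by []; rewrite -(ler_nat R) -(natr1 i); lra.
Qed.

Lemma rbinom_lt y z r : (0 < r)%N -> 0 <= z -> r%:R <= z + 1 -> z < y ->
  rbinom z r < rbinom y r.
Proof.
move=> r0 z0 rz zy; have y0 : 0 < y by lra.
have zE : z / y * y = z by rewrite divfK // gt_eqF.
have c1 : 0 <= z / y <= 1.
  apply/andP; split; first by apply: divr_ge0; lra.
  by rewrite ler_pdivrMr // mul1r; lra.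
rewrite -{1}zE; apply: le_lt_trans (rbinom_scale c1 _) _; first by rewrite zE.
rewrite gtr_pMl; last by apply: rbinom_gt0; lra.
by rewrite exprn_ilt1 -?lt0n //; [case/andP: c1|rewrite ltr_pdivrMr // mul1r].
Qed.

(** Scaling down by [rho^-1] gains [rho ^+ r.+1], of which one power is enough. This puts an edge
    count [rho * rbinom y r.+1] into the form that Lovasz's bound asks for. *)
Lemma rbinom_dilate (rho : R) y r : 1 <= rho -> r.+1%:R <= y ->
  rho * rbinom y r.+1 <= rbinom (rho * y) r.+1.
Proof.
move=> rho1 ry; have rho0 : 0 < rho by lra.
have yE : rho^-1 * (rho * y) = y by rewrite mulKf // gt_eqF.
have c1 : 0 <= rho^-1 <= 1 by rewrite invr_ge0 ltW //= invf_le1.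
have : rbinom y r.+1 <= rho^-1 ^+ r.+1 * rbinom (rho * y) r.+1.
  by rewrite -{1}yE; apply: rbinom_scale; rewrite // yE; lra.
rewrite exprVn mulrC ler_pdivlMr ?exprn_gt0 // => h.
apply: le_trans h; rewrite mulrC ler_wpM2l ?ler_eXnr //.
by apply/ltW/rbinom_gt0; lra.
Qed.

(** Each factor [y - i] is at least [y - r + 1], so lowering it by [t] costs at most the share
    [t / (y - r + 1)], and the [r] shares add up. *)
Lemma rbinom_shift_ge t y r : 0 <= t -> t <= y - r%:R + 1 ->
  r%:R < y + 1 ->
  (1 - r%:R * t / (y - r%:R + 1)) * rbinom y r <= rbinom (y - t) r.
Proof.
move=> t0 tw rw; set w := y - r%:R + 1 in tw *.
have w0 : 0 < w by rewrite /w; lra.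
rewrite /rbinom mulrA ler_wpM2r ?invr_ge0 ?ler0n //.
(* The induction shortens the product while [w] stays fixed, so the definition of [w] is weakened to
   an inequality that survives a smaller [r]. *)
have: r%:R + w <= y + 1 by rewrite /w; lra.
clearbody w; elim: r {rw} => [|r IH].
  by rewrite !big_ord0 !mul0r subr0 mulr1.
rewrite -natr1 => hw.
rewrite !big_ord_recr /=.
have hr : w <= y - r%:R by lra.
have P0 : 0 <= \prod_(i < r) (y - i%:R).
  apply: prodr_ge0 => i _; have : (i.+1 <= r)%N by [].
  by rewrite -(ler_nat R) -natr1; lra.
have {}IH : (1 - r%:R * t / w) * \prod_(i < r) (y - i%:R)
    <= \prod_(i < r) (y - t - i%:R) by apply: IH; lra.
apply: le_trans (_ : (1 - r%:R * t / w) * \prod_(i < r) (y - i%:R)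
   * (y - t - r%:R) <= _); last by rewrite ler_wpM2r //; lra.
set P := \prod_(_ < _) _ in P0 *.
suff : (1 - (r%:R + 1) * t / w) * (y - r%:R)
     <= (1 - r%:R * t / w) * (y - t - r%:R).
  move=> h; have := ler_wpM2l P0 h; lra.
rewrite -subr_ge0.
have -> : (1 - r%:R * t / w) * (y - t - r%:R) -
   (1 - (r%:R + 1) * t / w) * (y - r%:R) =
   t / w * (y - r%:R - w) + r%:R * t * t / w by field; rewrite gt_eqF.
have := ler0n R r => r0.
have w0' := ltW w0; apply: addr_ge0.
  by apply: mulr_ge0; [exact: divr_ge0|lra].
by rewrite divr_ge0 ?mulr_ge0.
Qed.

Lemma bernoulli_le t n : -1 <= t -> 1 + n%:R * t <= (1 + t) ^+ n.
Proof.
move=> t1; elim: n => [|n IH]; first by rewrite mul0r addr0.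
rewrite exprS -natr1; have n0 := ler0n R n.
have t0 : 0 <= 1 + t by lra.
apply: le_trans (ler_wpM2l t0 IH).
have : 0 <= n%:R * (t * t) by rewrite mulr_ge0 // -expr2 sqr_ge0.
lra.
Qed.

(** As [(1 - 4 * s) ^+ n * (1 + 4 * s) ^+ n <= 1], Bernoulli's inequality bounds the scaling factor
    by [1 / (1 + 4 * s * n)], which is at most [1 - 2 * s * n] while [4 * s * n <= 1]. *)
Lemma rbinom_shrink_le (s x : R) n : 0 <= s -> 0 <= x -> 4 * s * n%:R <= 1 ->
  0 <= 1 - 4 * s -> n%:R <= (1 - 4 * s) * x -> 
  rbinom ((1 - 4 * s) * x) n <= (1 - 2 * s * n%:R) * rbinom x n.
Proof.
move=> s0 x0 sn s1 nx.
have c1 : 0 <= 1 - 4 * s <= 1 by apply/andP; split; lra.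
apply: le_trans (rbinom_scale c1 _) _; first lra.
have nn := ler0n R n.
have {}x0 : n%:R <= x by have : 0 <= s * x by [rewrite mulr_ge0]; lra.
apply: ler_wpM2r; first by apply/ltW/rbinom_gt0; lra.
have p0 : 0 <= (1 - 4 * s) ^+ n by rewrite exprn_ge0.
have h1 : (1 - 4 * s) ^+ n * (1 + 4 * s) ^+ n <= 1.
  rewrite -exprMn; apply: exprn_ile1; first by apply: mulr_ge0; lra.
  have := sqr_ge0 s; rewrite expr2; lra.
have h2 : 1 + n%:R * (4 * s) <= (1 + 4 * s) ^+ n by apply: bernoulli_le; lra.
have h3 := le_trans (ler_wpM2l p0 h2) h1.
set p := (1 - 4 * s) ^+ n in p0 h1 h3 *.
have w0 : 0 <= n%:R * s by rewrite mulr_ge0.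
have h4 : 1 <= (1 - 2 * s * n%:R) * (1 + n%:R * (4 * s)).
  have : 0 <= (n%:R * s) * (1 - 4 * (n%:R * s)) by apply: mulr_ge0; lra.
  lra.
have d0 : 0 < 1 + n%:R * (4 * s) by lra.
by rewrite -(ler_pM2r d0); apply: le_trans h3 h4.
Qed.

(** The quotient is at most [1 / (1 - q)], and by Bernoulli its [n]-th power is at most 2. This
    makes the bounds of [exists_dense_core] linear in [q]. *)
Lemma rbinom_ratio_pow (b by_ q : R) n : 0 < by_ -> by_ <= b ->
  (1 - q) * b <= by_ -> 0 <= q -> q * n%:R <= 1 / 2 -> q <= 1 / 2 ->
  [/\ b / by_ <= 1 + 2 * q &
     (b / by_) ^+ n * (b / by_ - 1) * by_ <= 2 * q * b].
Proof.
move=> y0 yb hq q0 qn q1.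
set rho := b / by_.
have bE : b = rho * by_ by rewrite divfK ?gt_eqF.
have rho1 : 1 <= rho by rewrite ler_pdivlMr // mul1r.
have rq : rho * (1 - q) <= 1.
  by move: hq; rewrite bE mulrA -{2}[by_]mul1r ler_pM2r // mulrC.
split; first by have : 0 <= q * (1 - 2 * q) by [apply: mulr_ge0; lra]; nra.
have rho0 : 0 <= rho by lra.
have p0 : 0 <= rho ^+ n by rewrite exprn_ge0.
have h1 : rho ^+ n * (1 - q) ^+ n <= 1.
  by rewrite -exprMn; apply: exprn_ile1 => //; apply: mulr_ge0; lra.
have h2 : 1 + n%:R * - q <= (1 + - q) ^+ n by apply: bernoulli_le; lra.
have h3 := le_trans (ler_wpM2l p0 h2) h1.
have h4 : rho ^+ n <= 2.
  have : 0 <= rho ^+ n * (1 / 2 - q * n%:R) by apply: mulr_ge0; lra.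
  lra.
have -> : rho ^+ n * (rho - 1) * by_ = rho ^+ n * (b - by_) by rewrite bE; ring.
apply: le_trans (ler_wpM2r _ h4) _; lra.
Qed.

End Rbinom.

(** * Links, copies and induced subgraphs *)

Section Hypergraph.
Variable V : finType.
Implicit Types (E : {set {set V}}) (A e T : {set V}) (v : V) (r : nat).

Definition link E v : {set {set V}} :=
  [set e : {set V} | (v \notin e) && (v |: e \in E)].

Lemma is_rgraphP r E : reflect {in E, forall e, #|e| = r} (is_rgraph r E).
Proof. by apply: (iffP forall_inP) => h e /h /eqP. Qed.

Lemma is_rgraphS r E E' : E' \subset E -> is_rgraph r E -> is_rgraph r E'.
Proof. by move=> /subsetP sE /is_rgraphP h; apply/is_rgraphP => e /sE /h. Qed.

Lemma KcopiesP r E A :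
  reflect (#|A| = r.+1 /\ forall e, e \subset A -> #|e| = r -> e \in E)
          (A \in Kcopies r E).
Proof.
rewrite inE; apply: (iffP andP) => -[/eqP cA h]; split=> //.
  by move=> e eA ce; have /forallP/(_ e) := h; rewrite eA ce eqxx.
by apply/forallP => e; apply/implyP => /andP[/h he /eqP /he].
Qed.

Lemma Kcopies_rgraph r E : is_rgraph r.+1 (Kcopies r E).
Proof. by apply/is_rgraphP => A /KcopiesP[]. Qed.

Lemma Kcopies_face r E A v : A \in Kcopies r E -> v \in A -> A :\ v \in E.
Proof.
move=> /KcopiesP[cA h] vA; apply: h; first exact: subsetDl.
by move: cA; rewrite (cardsD1 v) vA => -[].
Qed.

Lemma link_rgraph r E v : is_rgraph r.+1 E -> is_rgraph r (link E v).
Proof.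
move=> /is_rgraphP h; apply/is_rgraphP => e; rewrite inE => /andP[ve /h].
by rewrite cardsU1 ve => -[].
Qed.

Lemma card_link E v : #|link E v| = degree E v.
Proof.
have inj : {in link E v &, injective (fun e => v |: e)}.
  move=> e e'; rewrite !inE => /andP[ve _] /andP[ve' _] eq.
  by rewrite -(setU1K ve) eq setU1K.
rewrite /degree -(card_in_imset inj); apply: eq_card => e; rewrite inE.
apply/imsetP/andP => [[e'] | [eE ve]].
  by rewrite inE => /andP[_ eE] ->; rewrite setU11.
by exists (e :\ v); rewrite ?inE ?setD1K // eqxx.
Qed.

Lemma degree_sum r E : is_rgraph r E -> (\sum_v degree E v = r * #|E|)%N.
Proof.
move=> /is_rgraphP h; rewrite mulnC -sum_nat_const.
rewrite (eq_bigr (fun e : {set V} => #|e|)) => [|e /h //].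
rewrite (eq_bigr (fun v => \sum_(e in E | v \in e) 1)%N); last first.
  by move=> v _; rewrite /degree -sum1dep_card.
under [RHS]eq_bigr do rewrite -sum1_card.
rewrite (exchange_big_dep (fun e => e \in E)) /= => [|v e _ /andP[] //].
by apply: eq_bigr => e eE; apply: eq_bigl => v; rewrite eE.
Qed.

Lemma Kcopies_link r E v A :
  A \in Kcopies r.+1 E -> v \in A -> A :\ v \in Kcopies r (link E v).
Proof.
move=> /KcopiesP[cA h] vA; apply/KcopiesP; split.
  by move: cA; rewrite (cardsD1 v) vA => -[].
move=> e; rewrite subsetD1 => /andP[eA ve] ce; rewrite inE ve /=.
by apply: h; rewrite ?subUset ?sub1set ?vA // cardsU1 ve ce.
Qed.

(** Deleting [v] is injective on the copies through it. The inequality can be strict: a copy [e] in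
    the link extends to [v |: e] only if [e] is itself an edge. *)
Lemma Kdegree_link r E v :
  (degree (Kcopies r.+1 E) v <= #|Kcopies r (link E v)|)%N.
Proof.
have inj : {in [set A in Kcopies r.+1 E | v \in A] &,
            injective (fun A => A :\ v)}.
  move=> A B; rewrite !inE => /andP[_ vA] /andP[_ vB] eq.
  by rewrite -(setD1K vA) eq setD1K.
rewrite /degree -(card_in_imset inj); apply: subset_leq_card.
apply/subsetP => _ /imsetP[A + ->]; rewrite inE => /andP[AK vA].
exact: Kcopies_link.
Qed.

(* The copies containing [v] correspond to the edges avoiding [v] that form a
   copy together with [v]. *)
Lemma Kdegree_edges r E v : is_rgraph r E ->
  (degree E v + degree (Kcopies r E) v +
   #|[set e in E | (v \notin e) && (v |: e \notin Kcopies r E)]| = #|E|)%N.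
Proof.
move=> rE; have inj : {in [set A in Kcopies r E | v \in A] &,
            injective (fun A => A :\ v)}.
  move=> A B; rewrite !inE => /andP[_ vA] /andP[_ vB] eq.
  by rewrite -(setD1K vA) eq setD1K.
rewrite {2}/degree -(card_in_imset inj).
have -> : [set A :\ v | A in [set A in Kcopies r E | v \in A]] =
  [set e in E | (v \notin e) && (v |: e \in Kcopies r E)].
  apply/setP => e; rewrite [RHS]inE; apply/imsetP/and3P => [[A] | [eE ve eK]].
    rewrite inE => /andP[AK vA ->]; rewrite (Kcopies_face AK) //.
    by rewrite setD1K ?AK // !inE eqxx.
  by exists (v |: e); rewrite ?setU1K // inE eK setU11.
rewrite -addnA -(cardsID [set e : {set V} | v \in e] E); congr (_ + _)%N.
  by apply: eq_card => e; rewrite !inE.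
rewrite -(cardsID [set e : {set V} | v |: e \in Kcopies r E] (E :\: _)).
move: (Kcopies r E) => K; congr (_ + _)%N; apply: eq_card => e; rewrite !inE;
  by do !case: (_ \in _).
Qed.

(** A copy through [v] has a second vertex, and dropping that one leaves an edge through [v]. *)
Lemma Kcopies_avoid0 r E v :
  is_rgraph r.+1 E -> degree E v = 0%N -> degree (Kcopies r.+1 E) v = 0%N.
Proof.
move=> rE dv; apply/eqP; rewrite cards_eq0; apply/eqP/setP => A.
rewrite !inE; apply/negbTE/negP => /andP[AK vA].
have AK' : A \in Kcopies r.+1 E by rewrite inE.
have /KcopiesP[cA _] := AK'.
have [w] : exists w, w \in A :\ v.
  apply/set0Pn; rewrite -card_gt0; move: cA.
  by rewrite (cardsD1 v) vA add1n => -[->].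
rewrite !inE => /andP[wv wA]; have := Kcopies_face AK' wA => eE.
move/eqP: dv; rewrite cards_eq0 => /eqP/setP/(_ (A :\ w)).
by rewrite !inE eE vA eq_sym wv.
Qed.

Definition induced E T : {set {set V}} := [set e in E | e \subset T].

Lemma induced_sub E T : induced E T \subset E.
Proof. by apply/subsetP => e; rewrite inE => /andP[]. Qed.

(** A copy has at least two vertices, so its faces cover it; if they all lie in [T], so does the
    copy. *)
Lemma Kcopies_induced r E T :
  Kcopies r.+1 (induced E T) = induced (Kcopies r.+1 E) T.
Proof.
apply/setP => A; rewrite [RHS]inE; apply/idP/andP => [AK|[AK AT]].
  have /KcopiesP[cA h] := AK; split.
    apply/KcopiesP; split=> // e eA ce.
    by have := h e eA ce; rewrite inE => /andP[].
  apply/subsetP => v vA.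
  have [w] : exists w, w \in A :\ v.
    apply/set0Pn; rewrite -card_gt0; move: cA.
    by rewrite (cardsD1 v) vA add1n => -[->].
  rewrite !inE => /andP[wv wA]; have := Kcopies_face AK wA.
  by rewrite inE => /andP[_ /subsetP]; apply; rewrite !inE eq_sym wv.
case/KcopiesP: AK => cA h; apply/KcopiesP; split=> // e eA ce.
by rewrite inE h // (subset_trans eA).
Qed.

Lemma induced_setD1 E T v : v \in T ->
  #|induced E T| = (degree (induced E T) v + #|induced E (T :\ v)|)%N.
Proof.
move=> vT; rewrite -(cardsID [set e : {set V} | v \in e]); congr (_ + _)%N.
  by apply: eq_card => e; rewrite !inE.
by apply: eq_card => e; rewrite !inE subsetD1; do !case: (_ \in _);
   rewrite ?andbF ?andbT.
Qed.

Lemma cards_outside E T :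
  (#|induced E T| + #|[set e in E | ~~ (e \subset T)]| = #|E|)%N.
Proof.
rewrite -[RHS](cardsID [set e : {set V} | e \subset T]); congr (_ + _)%N.
  by apply: eq_card => e; rewrite !inE.
by apply: eq_card => e; rewrite !inE andbC.
Qed.

End Hypergraph.

(** * Lovasz's bound, at each vertex and in total *)

Section Stability.
Variables (R : realType) (V : finType).
Implicit Types (E : {set {set V}}) (A e T : {set V}) (v : V) (r : nat).
Implicit Types (x y s : R).

Lemma Kcopies_le_of_degree r E x : is_rgraph r.+1 E ->
  (forall v, r.+1%:R * (degree (Kcopies r.+1 E) v)%:R
               <= (x - r.+1%:R) * (degree E v)%:R) ->
  r.+2%:R * #|Kcopies r.+1 E|%:R <= (x - r.+1%:R) * #|E|%:R.
Proof.
move=> rE h; have r0 : 0 < r.+1%:R :> R by rewrite ltr0Sn.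
rewrite -(ler_pM2l r0) [leRHS]mulrCA -!natrM.
rewrite -(degree_sum (Kcopies_rgraph r.+1 E)) -(degree_sum rE).
by rewrite natrM !natr_sum !mulr_sumr; apply: ler_sum.
Qed.

Lemma degreeD_Kdegree_le r E v : is_rgraph r E ->
  (degree E v)%:R + (degree (Kcopies r E) v)%:R <= #|E|%:R :> R.
Proof. by move=> rE; rewrite -natrD ler_nat -(Kdegree_edges v rE) leq_addr. Qed.

Lemma Kdegree_le_heavy r E x v : is_rgraph r.+1 E -> r.+1%:R <= x ->
  #|E|%:R <= rbinom x r.+1 -> rbinom (x - 1) r <= (degree E v)%:R ->
  r.+1%:R * (degree (Kcopies r.+1 E) v)%:R
    <= (x - r.+1%:R) * (degree E v)%:R.
Proof.
move=> rE rx Ex dB; have r0 : 0 < r.+1%:R :> R by rewrite ltr0Sn.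
have : r.+1%:R * ((degree E v)%:R + (degree (Kcopies r.+1 E) v)%:R)
       <= x * rbinom (x - 1) r.
  rewrite -rbinomSl ler_pM2l //; apply: le_trans Ex.
  exact: degreeD_Kdegree_le.
have : x * rbinom (x - 1) r <= x * (degree E v)%:R by rewrite ler_wpM2l //; lra.
lra.
Qed.

(** Induction on the uniformity. The link of a light vertex has too few edges for [x - 1], so its
    degrees obey the bound with [x - 1], and their sum bounds the copies in the link. *)
Lemma Kdegree_le r E x v : is_rgraph r.+1 E -> r.+1%:R <= x ->
  #|E|%:R <= rbinom x r.+1 ->
  r.+1%:R * (degree (Kcopies r.+1 E) v)%:R
    <= (x - r.+1%:R) * (degree E v)%:R.
Proof.
elim: r E x v => [|r IH] E x v rE rx Ex.
  case: (lerP (rbinom (x - 1) 0) (degree E v)%:R) => [|dB].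
    exact: Kdegree_le_heavy.
  (* For 1-edges the threshold is 1, so a light vertex has degree 0. *)
  move: dB; rewrite rbinom0 (ltr_nat R _ 1) ltnS leqn0 => /eqP d0.
  by rewrite d0 (Kcopies_avoid0 rE d0) !mulr0.
case: (lerP (rbinom (x - 1) r.+1) (degree E v)%:R) => [|dB].
  exact: Kdegree_le_heavy.
have rL := link_rgraph v rE; have rx' : r.+1%:R <= x - 1.
  by move: rx; rewrite -[r.+2%:R]natr1; lra.
rewrite -(card_link E v) in dB *.
have := Kcopies_le_of_degree rL (fun u => IH _ _ u rL rx' (ltW dB)).
have -> : x - 1 - r.+1%:R = x - r.+2%:R by rewrite -[r.+2%:R]natr1; ring.
by apply: le_trans; rewrite ler_wpM2l // ler_nat Kdegree_link.
Qed.

Lemma lovasz_Kcopies r E x : is_rgraph r.+1 E -> r.+1%:R <= x ->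
  #|E|%:R <= rbinom x r.+1 ->
  r.+2%:R * #|Kcopies r.+1 E|%:R <= (x - r.+1%:R) * #|E|%:R.
Proof.
by move=> rE rx Ex; apply: Kcopies_le_of_degree => // v; apply: Kdegree_le.
Qed.

(** The vertices outside [T] are removed one at a time. Every intermediate induced subgraph still
    has at most [rbinom x r.+1] edges, so [Kdegree_le] compares the copies and edges lost at each
    removal. *)
Lemma Kcopies_outside r E x T : is_rgraph r.+1 E -> r.+1%:R <= x ->
  #|E|%:R <= rbinom x r.+1 ->
  r.+1%:R * #|[set A in Kcopies r.+1 E | ~~ (A \subset T)]|%:R
    <= (x - r.+1%:R) * #|[set e in E | ~~ (e \subset T)]|%:R.
Proof.
move=> rE rx Ex; have [n] := ubnP #|~: T|; elim: n T => // n IH T.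
rewrite ltnS; case: (set_0Vmem (~: T)) => [T0 _|[v vT] cT].
  have -> : T = setT by rewrite -(setCK T) T0 setC0.
  have h (F : {set {set V}}) : [set e in F | ~~ (e \subset [set: V])] = set0.
    by apply/setP => e; rewrite !inE subsetT andbF.
  by rewrite !h cards0 !mulr0.
have vT' : v \in v |: T by rewrite setU11.
have TE : (v |: T) :\ v = T by rewrite setU1K // -in_setC.
have {IH} := IH (v |: T).
have -> : (#|~: (v |: T)| < n)%N.
  apply: leq_trans cT; rewrite [leqRHS](cardsD1 v) vT ltnS.
  by apply/subset_leq_card/subsetP => u; rewrite !inE negb_or.
move=> /(_ isT).
have := induced_setD1 E vT'; have := induced_setD1 (Kcopies r.+1 E) vT'.
rewrite TE -Kcopies_induced.
have := cards_outside E T; have := cards_outside E (v |: T).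
have := cards_outside (Kcopies r.+1 E) T.
have := cards_outside (Kcopies r.+1 E) (v |: T).
rewrite -!Kcopies_induced.
have sE := induced_sub E (v |: T).
have Ex' : #|induced E (v |: T)|%:R <= rbinom x r.+1.
  by apply: le_trans Ex; rewrite ler_nat subset_leq_card.
have := Kdegree_le v (is_rgraphS sE rE) rx Ex'.
move=> h h1 h2 h3 h4 h5 h6 h7.
have -> : #|[set A in Kcopies r.+1 E | ~~ (A \subset T)]| =
  (#|[set A in Kcopies r.+1 E | ~~ (A \subset v |: T)]| +
   degree (Kcopies r.+1 (induced E (v |: T))) v)%N by lia.
have -> : #|[set e in E | ~~ (e \subset T)]| =
  (#|[set e in E | ~~ (e \subset v |: T)]| +
   degree (induced E (v |: T)) v)%N by lia.
rewrite !natrD; lra.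
Qed.

(** * A dense core from iterated links *)

Lemma exists_degree_ratio r E : is_rgraph r.+1 E -> (0 < #|E|)%N ->
  exists v, (0 < degree E v)%N /\
   (r.+2 * #|Kcopies r.+1 E| * degree E v
      <= r.+1 * #|E| * degree (Kcopies r.+1 E) v)%N.
Proof.
move=> rE E0; have sd := degree_sum rE.
have sk := degree_sum (Kcopies_rgraph r.+1 E).
set K := #|Kcopies _ _| in sk *; set e := #|E| in E0 sd *.
case: (boolP [exists v, (0 < degree E v)%N &&
   (r.+2 * K * degree E v <= r.+1 * e * degree (Kcopies r.+1 E) v)%N]).
  by case/existsP => v /andP[]; exists v.
rewrite negb_exists => /forallP h.
(* If every vertex of positive degree fell below the average ratio, the indicator would record a
   strict loss there. Both sides have the same total, so all indicators vanish, against [E] being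
   nonempty. *)
have h' v : (r.+1 * e * degree (Kcopies r.+1 E) v + (0 < degree E v) <=
             r.+2 * K * degree E v)%N.
  have := h v; case: posnP => [d0 _|d0]; last by rewrite /= -ltnNge addn1.
  by rewrite d0 (Kcopies_avoid0 rE d0) !muln0.
have : (\sum_v (r.+1 * e * degree (Kcopies r.+1 E) v + (0 < degree E v)) <=
        \sum_v r.+2 * K * degree E v)%N by apply: leq_sum.
rewrite big_split /= -!big_distrr /= sd sk mulnC leqNgt -[X in (X < _)%N]addn0.
rewrite ltn_add2l lt0n sum_nat_eq0 => /negPn/forallP z.
have : (0 < \sum_v degree E v)%N by rewrite sd muln_gt0.
rewrite big1 // => v _; have := z v; rewrite eqb0 -leqNgt leqn0 => /eqP.
exact.
Qed.

(** With fewer edges, Lovasz's bound would hold for some [y - t] with [t > 0], and allow fewer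
    copies than assumed. *)
Lemma edges_ge_of_Kcopies r E y : is_rgraph r.+1 E -> (0 < #|E|)%N ->
  r.+1%:R <= y ->
  (y - r.+1%:R) * #|E|%:R <= r.+2%:R * #|Kcopies r.+1 E|%:R ->
  rbinom y r.+1 <= #|E|%:R.
Proof.
move=> rE E0 ry h; rewrite leNgt; apply/negP => Eb.
have e0 : 0 < #|E|%:R :> R by rewrite ltr0n.
have b0 : 0 < rbinom y r.+1 by lra.
have r0 : 0 < r.+1%:R :> R by rewrite ltr0Sn.
have ry' : r.+1%:R < y.
  rewrite lt_neqAle ry andbT; apply/eqP => yE; move: Eb.
  by rewrite -yE rbinom_nat binn ltr_nat ltnNge E0.
set w := y - r.+1%:R + 1; have w0 : 0 < w by rewrite /w; lra.
(* The first term keeps [y - t] at least [r.+1]; the second is the largest shift for which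
   [rbinom_shift_ge] still leaves room for [#|E|] edges. *)
pose t := Num.min (y - r.+1%:R) ((1 - #|E|%:R / rbinom y r.+1) * w / r.+1%:R).
have t0 : 0 < t.
  rewrite lt_min subr_gt0 ry' /= divr_gt0 // mulr_gt0 // subr_gt0.
  by rewrite ltr_pdivrMr // mul1r.
have ty : t <= y - r.+1%:R by rewrite ge_min lexx.
have tE : r.+1%:R * t / w <= 1 - #|E|%:R / rbinom y r.+1.
  by rewrite ler_pdivrMr // mulrC -ler_pdivlMr // ge_min lexx orbT.
have := @rbinom_shift_ge R t y r.+1 (ltW t0); rewrite -/w => hs.
have {}hs : (1 - r.+1%:R * t / w) * rbinom y r.+1 <= rbinom (y - t) r.+1.
  by apply: hs; rewrite ?/w; lra.
have Et : #|E|%:R <= rbinom (y - t) r.+1.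
  apply: le_trans hs; rewrite -ler_pdivrMr //; lra.
have rt : r.+1%:R <= y - t by lra.
have := lovasz_Kcopies rE rt Et; have : 0 < t * #|E|%:R by rewrite mulr_gt0.
lra.
Qed.

(** Discarding an element of least weight does not lower the average weight. *)
Lemma exists_heavy_subset (d : V -> nat) A c : (c <= #|A|)%N ->
  exists S : {set V}, [/\ S \subset A, #|S| = c &
    (c * \sum_(v in A) d v <= #|A| * \sum_(v in S) d v)%N].
Proof.
move=> cA; have [n] : exists n, n = (#|A| - c)%N by eexists.
elim: n c cA => [|n IH] c cA nE.
  by exists A; have <- : #|A| = c by lia.
have [||S1 [sS cS hS]] := IH c.+1; [lia|lia|].
have [u0 u0S] : exists u, u \in S1 by apply/set0Pn; rewrite -card_gt0 cS.
have := eq_refl u0; case: (arg_minnP d u0S) => u uS um _.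
have {}uS : u \in S1 := uS.
exists (S1 :\ u); split; first exact: subset_trans (subsetDl _ _) sS.
  by move: cS; rewrite (cardsD1 u) uS => -[].
have : (c.+1 * d u <= \sum_(v in S1) d v)%N.
  by rewrite -cS -sum_nat_const; apply: leq_sum.
rewrite (big_setD1 u uS) /= in hS *.
set s := (\sum_(v in S1 :\ u) d v)%N in hS *.
set a := (\sum_(v in A) d v)%N in hS *.
move=> hu; rewrite -(leq_pmul2l (ltn0Sn c)).
have : (c * d u <= s)%N by lia.
move=> /(leq_mul (leqnn #|A|)); have := leq_mul (leqnn c) hS; nia.
Qed.


(** An edge leaving [v |: T] either contains [v] and gives a link edge leaving [T], or forms no copy
    with [v], or forms one and is then a copy in the link leaving [T]. [Kdegree_edges] counts the
    middle kind. *)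
Lemma outside_link r E v T : is_rgraph r.+2 E ->
  (#|[set e in E | ~~ (e \subset v |: T)]| + degree E v
     + degree (Kcopies r.+2 E) v
   <= #|E| + #|[set e in link E v | ~~ (e \subset T)]|
     + #|[set A in Kcopies r.+1 (link E v) | ~~ (A \subset T)]|)%N.
Proof.
move=> rE; rewrite -(Kdegree_edges v rE).
set N := [set e in E | _ && _]; set mL := [set e in link E v | _].
set kL := [set A in Kcopies _ _ | _].
have : (#|[set e in E | ~~ (e \subset v |: T)]| <= #|N| + #|mL| + #|kL|)%N.
  apply: (@leq_trans #|(N :|: [set v |: e | e in mL]) :|: kL|); last first.
    apply: leq_trans (leq_card_setU _ _) _; rewrite leq_add2r.
    by apply: leq_trans (leq_card_setU _ _) _; rewrite leq_add2l leq_imset_card.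
  apply/subset_leq_card/subsetP => e; rewrite inE => /andP[eE eT].
  case: (boolP (v \in e)) => ve.
    apply/setUP; left; apply/setUP; right; apply/imsetP; exists (e :\ v).
      rewrite inE; apply/andP; split; last by rewrite subDset.
      by rewrite inE setD1K // eE !inE eqxx.
    by rewrite setD1K.
  case: (boolP (v |: e \in Kcopies r.+2 E)) => eK; last first.
    by apply/setUP; left; apply/setUP; left; rewrite inE eE ve.
  apply/setUP; right; rewrite inE; apply/andP; split.
    by rewrite -[e](setU1K ve); apply: Kcopies_link => //; rewrite setU11.
  by apply: contra eT => /subset_trans; apply; exact: subsetUr.
lia.
Qed.

Lemma exists_dense_core r E y : is_rgraph r.+1 E -> (0 < #|E|)%N ->
  r.+1%:R <= y ->
  (y - r.+1%:R) * #|E|%:R <= r.+2%:R * #|Kcopies r.+1 E|%:R ->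
  let rho := #|E|%:R / rbinom y r.+1 in
  exists T : {set V}, #|T|%:R - r%:R <= (y - r%:R) * rho /\
    #|[set e in E | ~~ (e \subset T)]|%:R
      <= r.+1%:R * rho ^+ r.+1 * (rho - 1) * rbinom y r.+1.
Proof.
elim: r E y => [|r IH] E y rE E0 ry hK rho.
  have := edges_ge_of_Kcopies rE E0 ry hK.
  have yE : rbinom y 1 = y by have := rbinomSr y 0; rewrite rbinom0; lra.
  rewrite {}/rho yE => ye; have y0 : 0 < y by lra.
  (* All edges are singletons here; their union misses none of them. *)
  exists [set v | [set v] \in E]; split.
    rewrite !subr0 mulrC divfK ?gt_eqF // ler_nat -(card_imset _ (@set1_inj V)).
    by apply/subset_leq_card/subsetP => _ /imsetP[v + ->]; rewrite inE.
  have -> : [set e in E | ~~ (e \subset [set v | [set v] \in E])] = set0.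
    apply/setP => e; rewrite !inE; apply/andP => -[eE].
    have /is_rgraphP/(_ e eE)/eqP/cards1P[v ve] := rE.
    by rewrite ve sub1set inE -ve eE.
  rewrite cards0 expr1 mul1r; apply: mulr_ge0; last lra.
  apply: mulr_ge0; first by rewrite divr_ge0 // ltW.
  by rewrite subr_ge0 ler_pdivlMr // mul1r.
have r2 : r.+2%:R = r.+1%:R + 1 :> R by rewrite natr1.
have r1 : r.+1%:R = r%:R + 1 :> R by rewrite natr1.
have r3 : r.+3%:R = r.+1%:R + 2 :> R by rewrite -addn2 natrD.
have r0 := ler0n R r.
have [v [d0 hv]] := exists_degree_ratio rE E0.
have rL := link_rgraph v rE.
have sum_le := degreeD_Kdegree_le v rE.
have := outside_link v _ rE; have := Kdegree_link r.+1 E v.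
rewrite -(card_link E v) in d0 hv sum_le *.
set L := link E v in d0 hv sum_le rL *.
set k := degree _ v in hv sum_le * => kL out.
have e0 : 0 < #|E|%:R :> R by rewrite ltr0n.
have {}hv : (y - r.+2%:R) * #|L|%:R <= r.+2%:R * k%:R.
  rewrite -(ler_pM2l e0).
  have : (y - r.+2%:R) * #|E|%:R * #|L|%:R
     <= r.+3%:R * #|Kcopies r.+2 E|%:R * #|L|%:R by rewrite ler_wpM2r.
  by move: hv; rewrite -(ler_nat R) !natrM; lra.
have ry1 : r.+1%:R <= y - 1 by lra.
have hL : (y - 1 - r.+1%:R) * #|L|%:R <= r.+2%:R * #|Kcopies r.+1 L|%:R.
  apply: (@le_trans _ _ (r.+2%:R * k%:R)); last first.
    by rewrite ler_wpM2l // ler_nat.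
  by apply: le_trans hv; rewrite r2; lra.
have := edges_ge_of_Kcopies rL d0 ry1 hL.
have [T [cT mT]] := IH _ _ rL d0 ry1 hL.
have {out}out := out T.
have b'0 : 0 < rbinom (y - 1) r.+1 by apply: rbinom_gt0; lra.
have b0 : 0 < rbinom y r.+2 by apply: rbinom_gt0; lra.
have bb' := rbinomSl y r.+1.
set rho' := _ / rbinom (y - 1) _ in cT mT => Lb.
have LE : #|L|%:R = rho' * rbinom (y - 1) r.+1 by rewrite divfK ?gt_eqF.
have EE : #|E|%:R = rho * rbinom y r.+2 by rewrite divfK ?gt_eqF.
have rho'1 : 1 <= rho' by rewrite ler_pdivlMr // mul1r.
(* The link has [rho' * rbinom (y - 1) r.+1] edges, so by [rbinom_dilate] the parameter
   [rho' * (y - 1)] is admissible for it. *)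
have hout := Kcopies_outside T rL (_ : _ <= rho' * (y - 1)) _.
have {}hout := hout (le_trans ry1 (ler_peMl (le_trans (ler0n _ _) ry1) rho'1)).
have {}hout := hout (_ : _); rewrite LE in hout.
have {}hout := hout (rbinom_dilate rho'1 ry1).
(* By the choice of [v], [y * #|L| <= r.+2 * (#|L| + k)], and [#|L| + k <= #|E|]. *)
have rr : rho' <= rho.
  have y0 : 0 < y by lra.
  suff : y * rbinom (y - 1) r.+1 * rho' <= r.+2%:R * rbinom y r.+2 * rho.
    by rewrite bb' ler_pM2l // mulr_gt0.
  have -> : y * rbinom (y - 1) r.+1 * rho' = y * #|L|%:R by rewrite LE; ring.
  have -> : r.+2%:R * rbinom y r.+2 * rho = r.+2%:R * #|E|%:R.
    by rewrite EE; ring.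
  have : r.+2%:R * (#|L|%:R + k%:R) <= r.+2%:R * #|E|%:R :> R.
    by rewrite ler_pM2l ?ltr0Sn.
  lra.
exists (v |: T); split.
  have : #|v |: T|%:R <= #|T|%:R + 1 :> R.
    by rewrite natr1 ler_nat cardsU1; case: (_ \notin _).
  have : (y - 1 - r%:R) * rho' <= (y - 1 - r%:R) * rho.
    by rewrite ler_wpM2l //; lra.
  have : y - r.+1%:R = y - 1 - r%:R by rewrite r1; ring.
  move=> ->; rewrite r1; lra.
move: out mT hout; rewrite -(ler_nat R) !natrD.
set m := #|[set e in E | _]|%:R; set m' := #|[set e in L | _]|%:R.
set k' := #|[set A in _ | _]|%:R => out mT hout.
have m'0 : 0 <= m' by rewrite ler0n.
have h1 : r.+1%:R * (m'+ k') <= rho' * (y - 1) * m' by lra.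
have h2 : m <= rbinom y r.+2 * (rho - rho') + (m' + k').
  suff : r.+2%:R * (#|E|%:R - #|L|%:R - k%:R) <=
         r.+2%:R * (rbinom y r.+2 * (rho - rho')).
    by rewrite ler_pM2l ?ltr0Sn //; lra.
  have -> : r.+2%:R * (rbinom y r.+2 * (rho - rho')) =
     r.+2%:R * #|E|%:R - y * #|L|%:R.
    have e1 : r.+2%:R * rbinom y r.+2 * rho' = y * rbinom (y - 1) r.+1 * rho'.
      by rewrite bb'.
    rewrite EE LE; lra.
  by rewrite !mulrBr; lra.
have h3 : m' + k' <= r.+2%:R * rho ^+ r.+2 * (rho' - 1) * rbinom y r.+2.
  have r10 : 0 < r.+1%:R :> R by rewrite ltr0Sn.
  rewrite -(ler_pM2l r10); apply: le_trans h1 _.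
  have p1 : 0 <= rho' * (y - 1) by apply: mulr_ge0; lra.
  apply: le_trans (ler_wpM2l p1 mT) _.
  have -> : rho' * (y - 1) * (r.+1%:R * rho' ^+ r.+1 * (rho' - 1) *
     rbinom (y - 1) r.+1) = r.+1%:R * (rho' ^+ r.+2 * ((rho' - 1) * ((y - 1) *
     rbinom (y - 1) r.+1))) by rewrite (exprS rho' r.+1); ring.
  rewrite ler_pM2l //.
  have -> : r.+2%:R * rho ^+ r.+2 * (rho' - 1) * rbinom y r.+2 =
     rho ^+ r.+2 * ((rho' - 1) * (r.+2%:R * rbinom y r.+2)) by ring.
  rewrite bb'; apply: ler_pM.
  - by rewrite exprn_ge0 //; lra.
  - apply: mulr_ge0; first lra.
    by apply: mulr_ge0; lra.
  - by rewrite lerXn2r ?nnegrE //; lra.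
  apply: ler_wpM2l; first lra.
  by apply: ler_wpM2r; lra.
apply: le_trans h2 _; apply: le_trans (lerD (lexx _) h3) _.
(* As [c >= 1], the loss [rho - rho'] of this step may also be weighted by [c], and it telescopes
   with [c * (rho' - 1)]. *)
set c := r.+2%:R * rho ^+ r.+2.
have c1 : 1 <= c.
  rewrite -[1]mulr1; apply: ler_pM => //; first by rewrite ler1n.
  by apply: exprn_ege1; lra.
have : 0 <= (c - 1) * (rho - rho') by apply: mulr_ge0; lra.
move=> /(mulr_ge0 (ltW b0)); lra.
Qed.


(** * Exceptional degrees, and cores of prescribed size *)

Lemma card_touching E (P : pred V) :
  (#|[set e in E | [exists v in e, P v]]| <= \sum_(v | P v) degree E v)%N.
Proof.
apply: leq_trans (_ : #|\bigcup_(v | P v) [set e in E | v \in e]| <= _)%N.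
  apply/subset_leq_card/subsetP => e.
  rewrite inE => /andP[eE /exists_inP[v ve Pv]].
  by apply/bigcupP; exists v; rewrite // inE eE.
elim/big_rec2: _ => [|v n A _ le]; first by rewrite cards0.
by apply: leq_trans (leq_card_setU _ _) _; rewrite leq_add2l.
Qed.

(** Each deficit is nonnegative by [Kdegree_le], so those over [P] are at most the total, which the
    degree sums evaluate. *)
Lemma Kdegree_deficit_sum r E x (P : pred V) : is_rgraph r.+1 E ->
  r.+1%:R <= x -> #|E|%:R <= rbinom x r.+1 ->
  \sum_(v | P v) ((x - r.+1%:R) * (degree E v)%:R -
                  r.+1%:R * (degree (Kcopies r.+1 E) v)%:R)
   <= r.+1%:R * ((x - r.+1%:R) * #|E|%:R - r.+2%:R * #|Kcopies r.+1 E|%:R).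
Proof.
move=> rE rx Ex.
have -> : r.+1%:R * ((x - r.+1%:R) * #|E|%:R - r.+2%:R * #|Kcopies r.+1 E|%:R)
  = \sum_v ((x - r.+1%:R) * (degree E v)%:R -
            r.+1%:R * (degree (Kcopies r.+1 E) v)%:R).
  rewrite sumrB -!mulr_sumr -!natr_sum (degree_sum rE).
  by rewrite (degree_sum (Kcopies_rgraph _ _)) !natrM; ring.
rewrite [leRHS](bigID P) /= lerDl sumr_ge0 // => v _.
by rewrite subr_ge0 Kdegree_le.
Qed.

Lemma Kdegree_le_light r E (z : R) v : (0 < r)%N -> is_rgraph r.+1 E ->
  r%:R <= z -> (degree E v)%:R <= rbinom z r ->
  r.+1%:R * (degree (Kcopies r.+1 E) v)%:R
    <= (z - r%:R) * (degree E v)%:R.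
Proof.
case: r => // r _ rE rz; rewrite -(card_link E v) => Lz.
apply: le_trans (lovasz_Kcopies (link_rgraph v rE) rz Lz).
by rewrite ler_wpM2l // ler_nat Kdegree_link.
Qed.

(* When [T] is too large, dropping its vertices of least degree loses at most
   the corresponding share of the degree sum [r * #|E|]. *)
Lemma resize_core r E T c x (a : R) : is_rgraph r E -> 0 <= a -> 0 < x ->
  x <= c%:R -> (c <= #|V|)%N -> #|T|%:R <= (1 + a) * x ->
  exists S : {set V}, #|S| = c /\
    #|[set e in E | ~~ (e \subset S)]|%:R
      <= #|[set e in E | ~~ (e \subset T)]|%:R + a * (r%:R * #|E|%:R).
Proof.
move=> rE a0 x0 xc cV Tx; case: (leqP #|T| c) => cT.
  (* Zero weights: only the size of the padding set matters. *)
  have [] := @exists_heavy_subset (fun=> 0%N) (~: T) (c - #|T|).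
    by rewrite [leqRHS]cardsCs setCK leq_sub2r.
  move=> U [UT cU _]; exists (T :|: U); split.
    rewrite cardsU cU; have -> : T :&: U = set0.
      by apply/eqP; rewrite setI_eq0 disjoints_subset -setCS setCK.
    by rewrite cards0 subn0 subnKC.
  rewrite -[leLHS]addr0 lerD ?mulr_ge0 // ler_nat.
  apply/subset_leq_card/subsetP => e; rewrite !inE => /andP[-> /=].
  by apply: contra => eT; apply: subset_trans eT (subsetUl _ _).
have [S [ST cS hS]] := exists_heavy_subset (degree E) (ltnW cT).
exists S; split=> //.
have hm : (#|[set e in E | ~~ (e \subset S)]| <=
  #|[set e in E | ~~ (e \subset T)]| + \sum_(v in T :\: S) degree E v)%N.
  apply: leq_trans (leq_add (leqnn _) (card_touching E (mem (T :\: S)))).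
  apply: leq_trans (leq_card_setU _ _).
  apply/subset_leq_card/subsetP => e; rewrite !inE => /andP[-> eS] /=.
  case: (boolP (e \subset T)) => //= /subsetP eT.
  have /subsetPn[v ve vS] := eS.
  by apply/exists_inP; exists v; rewrite // inE vS eT.
have sE : (\sum_(v in T) degree E v =
  \sum_(v in S) degree E v + \sum_(v in T :\: S) degree E v)%N.
  by rewrite (big_setID S) /= (setIidPr ST).
rewrite sE in hS.
set sD := (\sum_(v in T :\: S) _)%N in hm sE hS.
set sS := (\sum_(v in S) _)%N in sE hS.
have sT : (sS + sD <= r * #|E|)%N.
  by rewrite -sE -(degree_sum rE) [leqRHS](bigID (mem T)) leq_addr.
have tpos : 0 < #|T|%:R :> R by rewrite ltr0n; apply: leq_trans cT.
apply: le_trans (_ : _ <= #|[set e in E | ~~ (e \subset T)]|%:R + sD%:R) _.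
  by rewrite -natrD ler_nat.
rewrite lerD2l; move: hS sT (ltnW cT); rewrite -!(ler_nat R).
rewrite !(natrM, natrD) => hS sT {}cT.
set t := #|T|%:R in tpos hS cT Tx.
have s0 : 0 <= sS%:R + sD%:R :> R by rewrite addr_ge0.
have h1 : t * sD%:R <= (t - c%:R) * (sS%:R + sD%:R) by lra.
(* From [t <= (1 + a) * x] and [x <= c < t] one gets [t - c <= a * x <= a * t]. *)
have h2 : (t - c%:R) * (sS%:R + sD%:R) <= a * t * (sS%:R + sD%:R).
  apply: ler_wpM2r => //.
  have : a * x <= a * t by apply: ler_wpM2l => //; lra.
  lra.
have h3 : a * t * (sS%:R + sD%:R) <= a * t * (r%:R * #|E|%:R).
  by apply: ler_wpM2l => //; rewrite mulr_ge0 // ltW.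
by rewrite -(ler_pM2l tpos); lra.
Qed.


Lemma Kcopies_deficit_lt r E x s : #|E|%:R = rbinom x r.+1 ->
  (1 - s ^+ 2) * rbinom x r.+2 < #|Kcopies r.+1 E|%:R ->
  r.+1%:R * ((x - r.+1%:R) * #|E|%:R - r.+2%:R * #|Kcopies r.+1 E|%:R)
    < s ^+ 2 * (x - r.+1%:R) * (x * rbinom (x - 1) r).
Proof.
move=> cE hK; have r1 : 0 < r.+1%:R :> R by rewrite ltr0Sn.
have r2 : 0 < r.+2%:R :> R by rewrite ltr0Sn.
rewrite -rbinomSl [ltRHS]mulrCA ltr_pM2l // cE.
have := rbinomSr x r.+1 => hb.
have : r.+2%:R * ((1 - s ^+ 2) * rbinom x r.+2)
    < r.+2%:R * #|Kcopies r.+1 E|%:R.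
  by rewrite ltr_pM2l.
by rewrite mulrCA hb; lra.
Qed.

Lemma few_high_degree r E x s : 0 < s -> r.+1%:R < x ->
  is_rgraph r.+1 E -> #|E|%:R = rbinom x r.+1 ->
  (1 - s ^+ 2) * rbinom x r.+2 < #|Kcopies r.+1 E|%:R ->
  #|[set v : V | (1 + s) * rbinom (x - 1) r < (degree E v)%:R]|%:R <= s * x.
Proof.
move=> s0 rx rE cE hK.
set P := fun v : V => (1 + s) * rbinom (x - 1) r < (degree E v)%:R.
have r2 : r.+1%:R = r%:R + 1 :> R by rewrite natr1.
have B0 : 0 < rbinom (x - 1) r by apply: rbinom_gt0; lra.
have rp : 0 <= r%:R :> R by [].
have h1 := Kdegree_deficit_sum P rE (ltW rx) (_ : _ <= _).
have {}h1 := h1 (eq_ind _ (fun z => _ <= z) (lexx _) _ cE).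
have h2 := le_lt_trans h1 (Kcopies_deficit_lt cE hK).
(* By [K(v) <= |G| - d(v)] the deficit is at least [x * d(v) - x * rbinom (x - 1) r]. *)
have h3 : \sum_(v | P v) (x * s * rbinom (x - 1) r) <=
  \sum_(v | P v) ((x - r.+1%:R) * (degree E v)%:R -
                  r.+1%:R * (degree (Kcopies r.+1 E) v)%:R).
  apply: ler_sum => v Pv; have hb := rbinomSl x r.
  have : r.+1%:R * ((degree E v)%:R + (degree (Kcopies r.+1 E) v)%:R)
         <= r.+1%:R * rbinom x r.+1.
    by rewrite ler_pM2l ?ltr0Sn // -cE degreeD_Kdegree_le.
  have : x * ((1 + s) * rbinom (x - 1) r) <= x * (degree E v)%:R.
    by apply: ler_wpM2l; [lra|exact: ltW].
  lra.
have := le_lt_trans h3 h2; rewrite sumr_const.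
rewrite (_ : #|_| = #|[set v | P v]|); last by apply: eq_card => v; rewrite inE.
rewrite -[_ *+ _]mulr_natr.
set N := #|_|%:R => h.
have : x * s * rbinom (x - 1) r * N
    < x * s * rbinom (x - 1) r * (s * (x - r.+1%:R)).
  by rewrite expr2 in h; lra.
rewrite ltr_pM2l; last by apply: mulr_gt0 => //; apply: mulr_gt0; lra.
move=> /ltW/le_trans; apply; rewrite ler_pM2l //; lra.
Qed.

Lemma few_low_degree_edges r E x s : (0 < r)%N -> 0 < s -> r.+1%:R < x ->
  is_rgraph r.+1 E -> #|E|%:R = rbinom x r.+1 ->
  (1 - s ^+ 2) * rbinom x r.+2 < #|Kcopies r.+1 E|%:R ->
  r%:R <= (1 - s) * (x - 1) ->
  #|[set e in E | [exists v in e,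
      (degree E v)%:R < rbinom ((1 - s) * (x - 1)) r]]|%:R
    <= s * x * rbinom (x - 1) r.
Proof.
move=> r0 s0 rx rE cE hK rz.
set P := fun v : V => (degree E v)%:R < rbinom ((1 - s) * (x - 1)) r.
have r2 : r.+1%:R = r%:R + 1 :> R by rewrite natr1.
have B0 : 0 < rbinom (x - 1) r by apply: rbinom_gt0; lra.
have rp : 0 <= r%:R :> R by [].
have h1 := Kdegree_deficit_sum P rE (ltW rx) (_ : _ <= _).
have {}h1 := h1 (eq_ind _ (fun z => _ <= z) (lexx _) _ cE).
have h2 := le_lt_trans h1 (Kcopies_deficit_lt cE hK).
(* The bound for the link holds with [(1 - s) * (x - 1)] in place of [x - 1]; the difference
   [s * (x - 1)] is the gain per edge. *)
have h3 : \sum_(v | P v) (s * (x - 1) * (degree E v)%:R) <=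
  \sum_(v | P v) ((x - r.+1%:R) * (degree E v)%:R -
                  r.+1%:R * (degree (Kcopies r.+1 E) v)%:R).
  apply: ler_sum => v Pv.
  suff : r.+1%:R * (degree (Kcopies r.+1 E) v)%:R
     <= ((1 - s) * (x - 1) - r%:R) * (degree E v)%:R by rewrite r2; lra.
  exact: (Kdegree_le_light r0 rE rz (ltW Pv)).
have := le_lt_trans h3 h2; rewrite -mulr_sumr -natr_sum => h4.
apply: (@le_trans _ _ (\sum_(v | P v) degree E v)%:R).
  by rewrite ler_nat card_touching.
set D := (\sum_(v | P v) _)%:R in h4 *.
have h5 : s ^+ 2 * (x - r.+1%:R) * (x * rbinom (x - 1) r)
   <= s * (x - 1) * (s * x * rbinom (x - 1) r).
  have : 0 <= s * s * (x * rbinom (x - 1) r) * r%:R.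
    apply: mulr_ge0 => //; apply: mulr_ge0; first by apply: mulr_ge0; lra.
    by apply: mulr_ge0; lra.
  by rewrite r2 expr2; lra.
have := lt_le_trans h4 h5; rewrite ltr_pM2l; first exact: ltW.
by apply: mulr_gt0; lra.
Qed.

Lemma exists_core r E x s : 0 < s -> r.+1%:R < x ->
  is_rgraph r.+1 E -> #|E|%:R = rbinom x r.+1 ->
  (1 - s ^+ 2) * rbinom x r.+2 < #|Kcopies r.+1 E|%:R ->
  r.+1%:R * (r.+1%:R * s ^+ 2) <= 1 / 2 ->
  exists T : {set V},
    #|T|%:R <= (1 + 2 * (r.+1%:R * s ^+ 2)) * x /\
    #|[set e in E | ~~ (e \subset T)]|%:R
      <= 2 * r.+1%:R * (r.+1%:R * s ^+ 2) * rbinom x r.+1.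
Proof.
move=> s0 rx rE cE hK; set q := r.+1%:R * s ^+ 2 => nq.
have r2 : r.+1%:R = r%:R + 1 :> R by rewrite natr1.
have r3 : r.+2%:R = r%:R + 2 :> R by rewrite -addn2 natrD.
have rp : 0 <= r%:R :> R by [].
have s2 : 0 <= s ^+ 2 by rewrite exprn_ge0 // ltW.
have q0 : 0 <= q by rewrite mulr_ge0.
have q1 : q <= 1 / 2 by move: nq; rewrite r2; nra.
have s21 : s ^+ 2 <= 1 / 2 by move: q1; rewrite /q r2; nra.
have E0 : (0 < #|E|)%N by rewrite -(ltr_nat R) cE rbinom_gt0 //; lra.
(* Chosen so that [y - r.+1 = (1 - s ^+ 2) * (x - r.+1)], the ratio of copies to edges that the
   hypothesis supplies. *)
pose y := x - s ^+ 2 * (x - r.+1%:R).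
have xr0 : 0 < x - r.+1%:R by lra.
have t0 : 0 <= s ^+ 2 * (x - r.+1%:R) by rewrite mulr_ge0 // ltW.
have ty : s ^+ 2 * (x - r.+1%:R) <= x - r.+1%:R by rewrite ler_piMl //; lra.
have yx : y <= x by rewrite /y; lra.
have ry : r.+1%:R <= y by rewrite /y; lra.
have hy : (y - r.+1%:R) * #|E|%:R <= r.+2%:R * #|Kcopies r.+1 E|%:R.
  have r20 : 0 < r.+2%:R :> R by rewrite ltr0Sn.
  have hb := rbinomSr x r.+1.
  have : r.+2%:R * ((1 - s ^+ 2) * rbinom x r.+2)
      <= r.+2%:R * #|Kcopies r.+1 E|%:R.
    by rewrite ler_pM2l // ltW.
  by rewrite mulrCA hb -cE; apply: le_trans; rewrite /y; lra.
have by0 : 0 < rbinom y r.+1 by apply: rbinom_gt0; lra.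
have byx : rbinom y r.+1 <= rbinom x r.+1 by apply: rbinom_le => //; lra.
have bq : (1 - q) * rbinom x r.+1 <= rbinom y r.+1.
  apply: le_trans (rbinom_shift_ge t0 _ _); try lra.
  apply: ler_wpM2r; first by apply: le_trans byx; exact: ltW.
  rewrite lerD2l lerN2 mulrA -/q -mulrA -[leRHS]mulr1 ler_wpM2l //.
  by rewrite ler_pdivrMr; lra.
have [] := exists_dense_core rE E0 ry hy; rewrite cE => T [cT mT].
have {}nq : q * r.+1%:R <= 1 / 2 by rewrite mulrC.
have [] := rbinom_ratio_pow by0 byx bq q0 nq q1.
set rho := _ / _ in cT mT * => hr hm.
exists T; split.
  have yr : 0 <= y - r%:R by lra.
  have := ler_wpM2l yr hr.
  have : (y - r%:R) * (2 * q) <= x * (2 * q) by apply: ler_wpM2r; lra.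
  lra.
apply: le_trans mT _; have := ler_wpM2l (ler0n R r.+1) hm; lra.
Qed.

End Stability.

(** * The four conclusions *)

Theorem theorem9 (R : realType) (eps : R) (r : nat) (x delta : R)
    (V : finType) (E : {set {set V}}) :
  0 < eps -> eps < 1 / 2 ->
  (2 <= r)%N ->
  (1 + eps) * r.+1%:R <= x ->
  delta < (eps / (6 * r%:R)) ^+ 2 ->
  is_rgraph r E ->
  #|E|%:R = rbinom x r ->
  (1 - delta) * rbinom x r.+1 < #|Kcopies r E|%:R ->
  [/\ exists S : {set V},
        #|S|%:Z = Num.ceil x /\
        #|[set e in E | ~~ (e \subset S)]|%:R
          <= 10 * r%:R * (eps^-1 + 1) * Num.sqrt delta * rbinom x r,
      #|[set v : V | (1 + Num.sqrt delta) * rbinom (x - 1) r.-1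
                       < (degree E v)%:R]|%:R
        <= Num.sqrt delta * x,
      #|[set e in E | [exists v in e,
            (degree E v)%:R
              < rbinom ((1 - Num.sqrt delta) * (x - 1)) r.-1]]|%:R
        <= Num.sqrt delta * x * rbinom (x - 1) r.-1
    & exists C : {set V},
        #|C|%:R < (1 + 3 * r%:R * Num.sqrt delta) * x /\
        rbinom ((1 - 4 * Num.sqrt delta) * x) r.+1
          <= #|[set A in Kcopies r E | A \subset C]|%:R].

Proof.
case: r => [//|n] e0 e1; rewrite ltnS => n0 ex dlt rE cE hK.
have n1 : 1 <= n%:R :> R by rewrite ler1n.
have r1 : n.+1%:R = n%:R + 1 :> R by rewrite natr1.
have r2 : n.+2%:R = n%:R + 2 :> R by rewrite -addn2 natrD.
have ex0 : 0 <= eps * n.+2%:R by rewrite mulr_ge0 // ltW.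
have rx : n.+1%:R < x by lra.
have b20 : 0 < rbinom x n.+2 by apply: rbinom_gt0; lra.
have b0 : 0 < rbinom x n.+1 by apply: rbinom_gt0; lra.
have kle : #|Kcopies n.+1 E|%:R <= rbinom x n.+2.
  have Ex : #|E|%:R <= rbinom x n.+1 by rewrite cE.
  have := lovasz_Kcopies rE (ltW rx) Ex; rewrite cE -rbinomSr.
  by rewrite ler_pM2l ?ltr0Sn.
(* Lovasz's bound caps the copies at [rbinom x n.+2], which forces [delta > 0]. Hence
   [s ^+ 2 = delta], whereas [Num.sqrt] is 0 on negative reals. *)
have d0 : 0 < delta.
  by rewrite ltNge; apply/negP => dle; have := mulr_ge0_le0 (ltW b20) dle; lra.
set s := Num.sqrt delta.
have s0 : 0 < s by rewrite sqrtr_gt0.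
have s2 : s ^+ 2 = delta by rewrite sqr_sqrtr // ltW.
have sn : 6 * n.+1%:R * s < eps.
  have n6 : 0 < 6 * n.+1%:R :> R by lra.
  rewrite mulrC -ltr_pdivlMr // -(@ltr_pXn2r _ 2) ?nnegrE ?s2 ?divr_ge0 ?ltW //.
rewrite -s2 in hK; clear dlt.
set q := n.+1%:R * s ^+ 2.
have ns0 : 0 < n.+1%:R * s by apply: mulr_gt0; lra.
have qE : q = (n.+1%:R * s) * s by rewrite /q expr2 mulrA.
have s1 : s <= 1 / 24.
  have : n%:R * s >= 1 * s by rewrite ler_pM2r.
  by move: sn; rewrite r1; lra.
have nq : n.+1%:R * q <= eps / 6 * (n.+1%:R * s).
  have -> : n.+1%:R * q = n.+1%:R * s * (n.+1%:R * s) by rewrite qE; ring.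
  by rewrite ler_pM2r //; lra.
have nq2 : n.+1%:R * q <= 1 / 2.
  apply: le_trans nq _.
  have : eps * (n.+1%:R * s) <= 1 * (n.+1%:R * s) by rewrite ler_pM2r //; lra.
  lra.
have q0 : 0 <= q by rewrite qE; apply: mulr_ge0; apply: ltW.
have qs : q <= s / 12.
  have : 0 <= (1 / 12 - n.+1%:R * s) * s by apply: mulr_ge0; lra.
  by rewrite qE; lra.
have [T [cT mT]] := exists_core s0 rx rE cE hK nq2.
rewrite -/q in cT mT.
split.
(* A smaller vertex set could not hold [rbinom x n.+1] edges; so [V] has room for [S]. *)
- have xV : x <= #|V|%:R.
    rewrite leNgt; apply/negP => Vx.
    have [e eE] : exists e, e \in E.
      by apply/set0Pn; rewrite -card_gt0 -(ltr_nat R) cE.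
    have /is_rgraphP/(_ e eE) ce := rE.
    have nV : (n.+1 <= #|V|)%N by rewrite -ce max_card.
    have : (#|E| <= 'C(#|V|, n.+1))%N.
      rewrite -card_draws; apply/subset_leq_card/subsetP => f fE.
      by have /is_rgraphP/(_ f fE) cf := rE; rewrite inE cf.
    rewrite -(ler_nat R) -rbinom_nat cE leNgt => /negP; apply.
    by apply: rbinom_lt => //; rewrite natr1 ler_nat ltnW.
  have xc := ceil_ge x.
  have c0 : 0 <= Num.ceil x by rewrite ceil_ge0; lra.
  have cE' : Num.ceil x = `|Num.ceil x|%N%:Z by rewrite gez0_abs.
  have cV : (`|Num.ceil x| <= #|V|)%N.
    by rewrite -lez_nat -cE' ceil_le_int.
  have a0 : 0 <= 2 * q by lra.
  have x0 : 0 < x by lra.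
  rewrite {1}cE' in xc.
  have [S [cS mS]] := resize_core rE a0 x0 xc cV cT.
  exists S; split; first by rewrite cS -cE'.
  apply: le_trans mS _; rewrite cE.
  (* Half of the 4 comes from edges outside [T], half from resizing [T] with [a = 2 * q]. *)
  apply: le_trans (_ : 4 * (n.+1%:R * q) * rbinom x n.+1 <= _).
    by move: mT; lra.
  rewrite ler_pM2r //.
  have : 0 <= eps^-1 by rewrite invr_ge0 ltW.
  move=> /(mulr_ge0 (ltW ns0)) ie.
  have : eps * (n.+1%:R * s) <= 1 * (n.+1%:R * s) by rewrite ler_pM2r //; lra.
  lra.
- exact: few_high_degree s0 rx rE cE hK.
- apply: few_low_degree_edges n0 s0 rx rE cE hK _.
  have : 0 <= (1 - s) * (x - n.+2%:R) by apply: mulr_ge0; lra.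
  lra.
exists T; split.
  apply: le_lt_trans cT _; rewrite ltr_pM2r; last lra.
  have : 1 * s <= n%:R * s by rewrite ler_pM2r.
  by rewrite r1; lra.
have Ex : #|E|%:R <= rbinom x n.+1 by rewrite cE.
have := Kcopies_outside T rE (ltW rx) Ex.
have := cards_outside (Kcopies n.+1 E) T.
rewrite /induced => /(congr1 (fun k => k%:R : R)); rewrite natrD => ko.
set out := #|[set A in _ | ~~ _]|%:R in ko * => ho.
have {}ho : out <= 2 * q * (n.+2%:R * rbinom x n.+2).
  have r10 : 0 < n.+1%:R :> R by rewrite ltr0Sn.
  rewrite rbinomSr -(ler_pM2l r10); apply: le_trans ho _.
  have xr : 0 <= x - n.+1%:R by lra.
  have := ler_wpM2l xr mT; lra.
have se : s <= eps / 12.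
  have : 1 * s <= n%:R * s by rewrite ler_pM2r.
  by move: sn; rewrite r1; lra.
have w0 : 4 * s * n.+2%:R <= 1.
  by move: ns0 sn; rewrite r1 r2; lra.
(* The margin of [x] over [n.+2] pays for the shrinking: [s <= eps / 12] gives
   [(1 - 4 * s) * (1 + eps) >= 1]. *)
have xn : n.+2%:R <= (1 - 4 * s) * x.
  have s41 : 0 <= 1 - 4 * s by lra.
  apply: le_trans (ler_wpM2l s41 ex).
  rewrite mulrA ler_peMl //.
  have : 0 <= (eps / 12 - s) * (1 + eps) by apply: mulr_ge0; lra.
  have : 0 <= eps * (1 - eps) by apply: mulr_ge0; lra.
  lra.
have x0 : 0 <= x by lra.
apply: le_trans (rbinom_shrink_le (ltW s0) x0 w0 _ xn) _; first lra.
(* The first term is for the copies missing from [E], the second for those not inside [T]. *)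
suff : (s ^+ 2 + 2 * q * n.+2%:R) * rbinom x n.+2
    <= 2 * s * n.+2%:R * rbinom x n.+2.
  rewrite /induced in ko; move: ho hK ko; lra.
rewrite ler_pM2r //.
have s2s : s ^+ 2 <= s * n.+2%:R.
  by rewrite expr2 ler_pM2l //; lra.
have : 2 * q * n.+2%:R <= s / 6 * n.+2%:R by apply: ler_wpM2r => //; lra.
have : 0 <= s * n.+2%:R by rewrite mulr_ge0 // ltW.
lra.
Qed.
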